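(* Let $\lambda$ be a nonzero real number and let $\phi_{n,\lambda}$ ($n\ge 0$) be the degenerate Bell numbers. Then for every integer $n\ge 0$, $$\phi_{n+1,\lambda}=\sum_{k=0}^{n}\binom{n}{k}(1-\lambda)_{n-k,\lambda}\,\phi_{k,\lambda},$$ and $$\phi_{n,\lambda}=\sum_{k=0}^{n}\binom{n}{k}(-1)^{n-k}\langle 1-\lambda\rangle_{n-k,\lambda}\,\phi_{k+1,\lambda}.$$
   Context: For a nonzero real number $\lambda$: generalized falling factorials $(x)_{0,\lambda}=1$, $(x)_{n,\lambda}=x(x-\lambda)\cdots(x-(n-1)\lambda)$ for $n\ge 1$; generalized rising factorials $\langle x\rangle_{0,\lambda}=1$, $\langle x\rangle_{n,\lambda}=x(x+\lambda)\cdots(x+(n-1)\lambda)$ for $n\ge 1$. With $(x)_0=1$ and $(x)_n=x(x-1)\cdots(x-n+1)$ for $n\ge 1$, the degenerate Stirling numbers of the second kind ${n \brace k}_{\lambda}$ ($0\le k\le n$) are defined by the polynomial identity $(x)_{n,\lambda}=\sum_{k=0}^{n}{n \brace k}_{\lambda}(x)_{k}$, $n\ge 0$. The degenerate Bell numbers are $\phi_{n,\lambda}=\sum_{k=0}^{n}{n \brace k}_{\lambda}$. *)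

(* Defs.v *)
From mathcomp Require Import all_boot all_order all_algebra.
From mathcomp Require Import reals.

Set Implicit Arguments.
Unset Strict Implicit.
Unset Printing Implicit Defensive.

Import Order.TTheory GRing.Theory Num.Theory.

Local Open Scope ring_scope.

(* The factorials are over an arbitrary commutative ring, so as to be used
   both at numbers and at the indeterminate 'X. *)

(* (x)_n *)
Definition falling (A : comNzRingType) (x : A) (n : nat) : A :=
  \prod_(i < n) (x - i%:R).

(* (x)_{n,lam} *)
Definition gfalling (A : comNzRingType) (lam x : A) (n : nat) : A :=
  \prod_(i < n) (x - i%:R * lam).

(* <x>_{n,lam} *)
Definition grising (A : comNzRingType) (lam x : A) (n : nat) : A :=
  \prod_(i < n) (x + i%:R * lam).

Section FallingBasis.

Variable R : idomainType.

Lemma falling_monic (n : nat) : falling ('X : {poly R}) n \is monic.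
Proof. by apply: monic_prod => i _; rewrite -polyC_natr monicXsubC. Qed.

Lemma size_falling (n : nat) : size (falling ('X : {poly R}) n) = n.+1.
Proof.
rewrite /falling; under eq_bigr => i _ do rewrite -polyC_natr.
by rewrite size_prod_XsubC /index_enum -enumT size_enum_ord.
Qed.

Lemma size_gfalling (lam : R) (n : nat) :
  size (gfalling lam%:P ('X : {poly R}) n) = n.+1.
Proof.
rewrite /gfalling; under eq_bigr => i _ do rewrite -polyC_natr -polyCM.
by rewrite size_prod_XsubC /index_enum -enumT size_enum_ord.
Qed.

Lemma falling_coords (n : nat) (p : {poly R}) : (size p <= n)%N ->
  exists c : {ffun 'I_n -> R},
    p == \sum_(k < n) (c k)%:P * falling 'X k.
Proof.
elim: n p => [|n IHn] p szp.
  by exists 0; rewrite big_ord0 -size_poly_leq0.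
have [|c /eqP pE] := IHn (p - (p`_n)%:P * falling 'X n).
  apply/leq_sizeP => j le_nj; rewrite coefB coefCM.
  move: le_nj; rewrite leq_eqVlt => /predU1P[<-|lt_nj].
    have := falling_monic n; rewrite monicE lead_coefE size_falling /=.
    by move=> /eqP->; rewrite mulr1 subrr.
  rewrite [p`_j]nth_default ?(leq_trans szp) //.
  by rewrite [_`_j]nth_default ?size_falling // mulr0 subrr.
exists [ffun k : 'I_n.+1 => if unlift ord_max k is Some i then c i else p`_n].
rewrite big_ord_recr /= ffunE unlift_none.
under eq_bigr => i _.
  have -> : widen_ord (leqnSn n) i = lift ord_max i.
    by apply: val_inj; rewrite /= /bump leqNgt ltn_ord.
  rewrite ffunE liftK; over.
by rewrite -pE subrK.
Qed.

Lemma falling_free (n : nat) (c d : 'I_n -> R) :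
  \sum_(k < n) (c k)%:P * falling 'X k =
    \sum_(k < n) (d k)%:P * falling ('X : {poly R}) k -> c =1 d.
Proof.
elim: n c d => [|n IHn] c d; first by move=> _ [].
rewrite !big_ord_recr /= => cdE.
have coefn (e : 'I_n.+1 -> R) :
    (\sum_(k < n) (e (widen_ord (leqnSn n) k))%:P * falling ('X : {poly R}) k
      + (e ord_max)%:P * falling 'X n)`_n = e ord_max.
  rewrite coefD coef_sum big1 => [|k _]; last first.
    by rewrite coefCM [_`_n]nth_default ?size_falling ?mulr0.
  rewrite add0r coefCM; have := falling_monic n.
  by rewrite monicE lead_coefE size_falling /= => /eqP->; rewrite mulr1.
have cd_max : c ord_max = d ord_max by rewrite -coefn cdE coefn.
move: cdE; rewrite cd_max => /addIr /IHn cd k.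
have [i ->|->//] := unliftP ord_max k.
suff -> : lift ord_max i = widen_ord (leqnSn n) i by exact: cd.
by apply: val_inj; rewrite /= /bump leqNgt ltn_ord.
Qed.

End FallingBasis.

Section DegenerateNumbers.

Variable R : realType.

Lemma dstirling2_exists (lam : R) (n : nat) :
  exists c : {ffun 'I_n.+1 -> R},
    gfalling lam%:P 'X n == \sum_(k < n.+1) (c k)%:P * falling 'X k.
Proof. by apply: falling_coords; rewrite size_gfalling. Qed.

(* The coefficients are characterized by [dstirling2P] and
   [dstirling2_unique]; the value for k > n is irrelevant and set to 0. *)
Definition dstirling2 (lam : R) (n k : nat) : R :=
  if insub k is Some i then xchoose (dstirling2_exists lam n) i else 0.

Lemma dstirling2P (lam : R) (n : nat) :
  gfalling lam%:P 'X n =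
    \sum_(k < n.+1) (dstirling2 lam n k)%:P * falling 'X k.
Proof.
rewrite {1}(eqP (xchooseP (dstirling2_exists lam n))).
by apply: eq_bigr => k _; rewrite /dstirling2 valK.
Qed.

Lemma dstirling2_unique (lam : R) (n : nat) (c : nat -> R) :
  gfalling lam%:P 'X n = \sum_(k < n.+1) (c k)%:P * falling 'X k ->
  forall k, (k <= n)%N -> c k = dstirling2 lam n k.
Proof.
rewrite dstirling2P => E k le_kn.
exact/esym/(falling_free E (Ordinal (le_kn : (k < n.+1)%N))).
Qed.

Definition dbell (lam : R) (n : nat) : R :=
  \sum_(k < n.+1) dstirling2 lam n k.

End DegenerateNumbers.

(* Main.v *)
Require Import Defs.
From HB Require Import structures.
From mathcomp Require Import all_boot all_order all_algebra.
From mathcomp Require Import reals.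
From mathcomp Require Import ring.

Import Order.TTheory GRing.Theory Num.Theory.
Local Open Scope ring_scope.

(** The argument is umbral.  Let [L] be the linear functional on polynomials
sending every falling factorial (X)_k to 1, so that the degenerate Bell number
of index n is L((X)_{n,lam}) ([bell_umbra_gfalling]).  Since
X * (X - 1)_k = (X)_{k+1}, the functional satisfies L(X * p(X - 1)) = L(p) for
every polynomial p ([bell_umbra_shift]).

Generalized falling factorials are of binomial type ([gfallingD]).  As
(X)_{n+1,lam} = X * (X - lam)_{n,lam}, expanding the last factor along
X - lam = (X - 1) + (1 - lam) and applying [L] gives the first identity.
Conversely L((X)_{n,lam}) = L(X * (X - 1)_{n,lam}), and expanding along
X - 1 = (X - lam) + (lam - 1) gives the second one, because
(lam - 1)_{m,lam} = (-1)^m <1 - lam>_{m,lam}. *)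

Section GeneralizedFactorials.

Set Implicit Arguments.
Unset Strict Implicit.

Variable A : comNzRingType.
Implicit Types lam x y : A.

Lemma gfalling0 lam x : gfalling lam x 0 = 1.
Proof. by rewrite /gfalling big_ord0. Qed.

Lemma gfallingSr lam x n :
  gfalling lam x n.+1 = gfalling lam x n * (x - n%:R * lam).
Proof. by rewrite /gfalling big_ord_recr. Qed.

Lemma gfallingS lam x n :
  gfalling lam x n.+1 = x * gfalling lam (x - lam) n.
Proof.
rewrite /gfalling big_ord_recl mul0r subr0; congr (_ * _).
by apply: eq_bigr => i _; rewrite /= /bump add1n mulrS mulrDl mul1r opprD addrA.
Qed.

Lemma fallingE x n : falling x n = gfalling 1 x n.
Proof. by apply: eq_bigr => i _; rewrite mulr1. Qed.

Lemma fallingS x n : falling x n.+1 = x * falling (x - 1) n.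
Proof. by rewrite !fallingE gfallingS. Qed.

Lemma gfallingN lam x n : gfalling lam (- x) n = (-1) ^+ n * grising lam x n.
Proof.
elim: n => [|n IHn]; first by rewrite gfalling0 /grising big_ord0 mulr1.
by rewrite gfallingSr IHn /grising big_ord_recr /= exprS; ring.
Qed.

(** The Vandermonde convolution: generalized falling factorials are of
binomial type. *)
Lemma gfallingD lam x y n :
  gfalling lam (x + y) n =
    \sum_(k < n.+1) 'C(n, k)%:R * gfalling lam y (n - k) * gfalling lam x k.
Proof.
elim: n => [|n IHn]; first by rewrite big_ord1 !gfalling0 bin0 !mulr1.
(* The factor x + y - n lam is split, in the term of index k, as
   (x - k lam) + (y - (n - k) lam). *)
have step (k : 'I_n.+1) :
    'C(n, k)%:R * gfalling lam y (n - k) * gfalling lam x k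
      * (x + y - n%:R * lam) =
    'C(n, k)%:R * gfalling lam y (n - k) * gfalling lam x k.+1
    + 'C(n, k)%:R * gfalling lam y (n.+1 - k) * gfalling lam x k.
  have le_kn : (k <= n)%N by rewrite -ltnS.
  rewrite subSn // !gfallingSr natrB //; ring.
rewrite gfallingSr IHn mulr_suml; under eq_bigr => k _ do rewrite step.
rewrite big_split /= [RHS]big_ord_recl /= bin0.
under [in RHS]eq_bigr => k _ do
  rewrite /bump add1n binS subSS natrD [(_ + _ : A)]addrC !mulrDl.
rewrite big_split /= [RHS]addrCA; congr (_ + _).
rewrite big_ord_recl bin0 [in RHS]big_ord_recr /= bin_small // !mul0r addr0.
by congr (_ + _); apply: eq_bigr => k _; rewrite /= /bump add1n subSS.
Qed.

Lemma rmorph_gfalling (B : comNzRingType) (f : {rmorphism A -> B}) lam x n :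
  f (gfalling lam x n) = gfalling (f lam) (f x) n.
Proof.
rewrite /gfalling rmorph_prod; apply: eq_bigr => i _.
by rewrite rmorphB rmorphM rmorph_nat.
Qed.

End GeneralizedFactorials.

Section BellUmbra.

Set Implicit Arguments.
Unset Strict Implicit.

Variable R : idomainType.
Implicit Types (p q : {poly R}) (c : nat -> R).

Lemma falling_expansion p n : (size p <= n)%N ->
  exists c, p = \sum_(k < n) (c k)%:P * falling 'X k.
Proof.
move=> /falling_coords[c /eqP pE].
exists (fun k => if insub k is Some i then c i else 0).
by rewrite {1}pE; apply: eq_bigr => k _; rewrite valK.
Qed.

(** The Bell umbra: the sum of the coordinates of a polynomial in the basis of
falling factorials, that is, the linear functional which takes the value 1 on
each of them. *)
Definition bell_umbra p : R :=
  \sum_(k < size p) xchoose (falling_coords (leqnn (size p))) k.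

Lemma size_falling_sum n c :
  (size (\sum_(k < n) (c k)%:P * falling ('X : {poly R}) k)%R <= n)%N.
Proof.
apply: leq_trans (size_sum _ _ _) _; apply/bigmax_leqP => k _.
by rewrite mul_polyC (leq_trans (size_scale_leq _ _)) // size_falling.
Qed.

(** Any expansion along falling factorials, possibly longer than the degree
requires, computes [bell_umbra]. *)
Lemma bell_umbraE p n c :
  p = \sum_(k < n) (c k)%:P * falling 'X k -> bell_umbra p = \sum_(k < n) c k.
Proof.
move=> pE; have le_pn : (size p <= n)%N by rewrite pE size_falling_sum.
rewrite /bell_umbra; move: (xchooseP (falling_coords (leqnn (size p)))).
move: (xchoose _) => d /eqP pE'.
pose e k := if insub k is Some i then d i else 0.
have eE (k : 'I_(size p)) : d k = e k by rewrite /e valK.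
have e0 k : (size p <= k)%N -> e k = 0.
  by move=> le_pk; rewrite /e insubF // ltnNge le_pk.
have widen (V : nmodType) (F : nat -> V) :
    (forall k, (size p <= k)%N -> F k = 0) ->
    \sum_(k < size p) F k = \sum_(k < n) F k.
  move=> F0; rewrite (big_ord_widen _ _ le_pn) big_mkcond /=.
  by apply: eq_bigr => k _; case: ltnP => // /F0.
under eq_bigr => k _ do rewrite eE.
rewrite widen //; apply: eq_bigr => k _; apply: (@falling_free _ n e c _ k).
rewrite -pE pE' -(widen _ (fun k => (e k)%:P * falling 'X k)) => [|j le_pj].
  by apply: eq_bigr => j _; rewrite eE.
by rewrite e0 ?mul0r.
Qed.

Lemma bell_umbra_is_scalar : scalar bell_umbra.
Proof.
move=> a p q; pose n := maxn (size p) (size q).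
have [c pE] := @falling_expansion p n (leq_maxl _ _).
have [d qE] := @falling_expansion q n (leq_maxr _ _).
rewrite (bell_umbraE pE) (bell_umbraE qE) mulr_sumr -big_split.
apply: (@bell_umbraE _ n (fun k => a * c k + d k)).
rewrite {1}pE {1}qE scaler_sumr -big_split; apply: eq_bigr => k _ /=.
by rewrite polyCD polyCM mulrDl -mul_polyC mulrA.
Qed.

HB.instance Definition _ :=
  GRing.isLinear.Build R {poly R} R *%R bell_umbra bell_umbra_is_scalar.

Lemma bell_umbra_falling n : bell_umbra (falling 'X n) = 1.
Proof.
have E : falling 'X n =
    \sum_(k < n.+1) ((k == n :> nat)%:R : R)%:P * falling 'X k.
  rewrite big_ord_recr /= eqxx mul1r big1 ?add0r // => k _.
  by rewrite ltn_eqF // mul0r.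
rewrite (bell_umbraE (c := fun k => (k == n)%:R) E) big_ord_recr /= eqxx.
by rewrite big1 ?add0r // => k _; rewrite ltn_eqF.
Qed.

(** The umbral form of the recurrence of Bell numbers; it suffices to check it
on falling factorials. *)
Lemma bell_umbra_shift p : bell_umbra ('X * (p \Po ('X - 1))) = bell_umbra p.
Proof.
have [c ->] := @falling_expansion p _ (leqnn _).
rewrite !raddf_sum mulr_sumr raddf_sum /=; apply: eq_bigr => k _.
rewrite rmorphM /= comp_polyC mulrCA !fallingE rmorph_gfalling /= comp_polyX.
rewrite rmorph1 -!fallingE -fallingS !mul_polyC !linearZ /=.
by rewrite !bell_umbra_falling.
Qed.

End BellUmbra.

Lemma bell_umbra_gfalling (R : realType) (lam : R) n :
  bell_umbra (gfalling lam%:P 'X n) = dbell lam n.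
Proof. exact: bell_umbraE (dstirling2P lam n). Qed.

Lemma bell_umbra_shift_gfalling (R : realType) (lam : R) n :
  bell_umbra ('X * gfalling lam%:P ('X - 1) n) = dbell lam n.
Proof.
rewrite -bell_umbra_gfalling -[RHS]bell_umbra_shift rmorph_gfalling /=.
by rewrite comp_polyC comp_polyX.
Qed.

(** Binomial expansion of X * (q + a)_{n,lam} under the Bell umbra, for a
scalar a: both recurrences are instances of it. *)
Lemma bell_umbra_gfallingD (R : idomainType) (lam a : R) (q : {poly R}) n :
  bell_umbra ('X * gfalling lam%:P (q + a%:P) n) =
    \sum_(k < n.+1) 'C(n, k)%:R * gfalling lam a (n - k)
      * bell_umbra ('X * gfalling lam%:P q k).
Proof.
rewrite gfallingD mulr_sumr raddf_sum; apply: eq_bigr => k _ /=.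
rewrite -rmorph_gfalling -polyC_natr -polyCM mulrCA mul_polyC.
by rewrite linearZ.
Qed.

Theorem theorem2p6 (R : realType) (lam : R) (hlam : lam != 0) (n : nat) :
  dbell lam n.+1 =
    \sum_(k < n.+1) 'C(n, k)%:R * gfalling lam (1 - lam) (n - k) * dbell lam k
  /\
  dbell lam n =
    \sum_(k < n.+1) 'C(n, k)%:R * (-1) ^+ (n - k)
      * grising lam (1 - lam) (n - k) * dbell lam k.+1.
Proof.
split.
  rewrite -bell_umbra_gfalling gfallingS.
  have -> : 'X - lam%:P = ('X - 1) + (1 - lam)%:P by rewrite polyCB addrA subrK.
  rewrite bell_umbra_gfallingD; apply: eq_bigr => k _.
  by rewrite bell_umbra_shift_gfalling.
rewrite -bell_umbra_shift_gfalling.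
have -> : 'X - 1 = ('X - lam%:P) + (- (1 - lam))%:P.
  by rewrite opprB polyCB addrA subrK.
rewrite bell_umbra_gfallingD; apply: eq_bigr => k _.
by rewrite -gfallingS bell_umbra_gfalling gfallingN !mulrA.
Qed.
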